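(* Let $m\ge2$, let $p_1,\dots,p_m>0$ with $\sum_i p_i=1$ be linearly independent over $\mathbb{Q}$, and let $\gamma\in\mathbb{R}$. For the $\gamma$-quota method, with $N$ uniformly distributed on $\{1,\dots,N_0\}$, as $N_0\to\infty$, for every $i$, $$\operatorname{Var}\Delta_i\to\frac{1+(m-2)/m^2}{12}=\frac{(m+2)(m-1)}{12m^2}.$$
   Context: There are $m$ parties; party $i$ has proportion $p_i>0$ of the votes. $N$ (the house size) seats are distributed, party $i$ gets $s_i=s_i(N)$ seats with $\sum_i s_i=N$, and the seat excess is $\Delta_i=s_i-Np_i$. For real $\alpha,x$, the $\alpha$-rounding $[x]_\alpha$ is an integer $n$ with $x-\alpha\le n\le x-\alpha+1$ (if $x-\alpha\in\mathbb{Z}$, both $x-\alpha$ and $x-\alpha+1$ are accepted values). The $\gamma$-quota method (for $N+\gamma>0$): $s_i=[(N+\gamma)p_i]_\alpha$ for all $i$, where the real number $\alpha$ (and the choices of rounding in case of ties) are such that $\sum_i s_i=N$. Ties are resolved at random. Finitely many $N$ with $N+\gamma\le0$ are irrelevant for the limit and may be ignored. *)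

(* Defs.v *)
From mathcomp Require Import all_boot all_order all_algebra.
From mathcomp Require Import all_classical all_reals all_analysis.

Set Implicit Arguments.
Unset Strict Implicit.
Unset Printing Implicit Defensive.

Import Order.TTheory GRing.Theory Num.Theory.
Import numFieldNormedType.Exports.

Local Open Scope classical_set_scope.
Local Open Scope ring_scope.

Definition lin_indep_rat (R : realType) (m : nat) (p : 'I_m -> R) : Prop :=
  forall q : 'I_m -> rat,
    \sum_i ratr (q i) * p i = 0 -> forall i, q i = 0.

(* When x - alpha is an integer both x - alpha and x - alpha + 1 qualify, so
   this is a relation rather than a function of alpha and x. *)
Definition alpha_rounding (R : realType) (alpha x : R) (n : int) : Prop :=
  x - alpha <= n%:~R <= x - alpha + 1.

(* s is one of the seat vectors that the gamma-quota method may produce for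
   the house size N; there are several of them exactly when there is a tie. *)
Definition quota_seats (R : realType) (m : nat) (gamma : R) (p : 'I_m -> R)
    (N : nat) (s : 'I_m -> int) : Prop :=
  (exists alpha : R,
      forall i, alpha_rounding alpha ((N%:R + gamma) * p i) (s i)) /\
  \sum_i s i = N%:Z.

Definition uniform_1_to (R : realType) (d : measure_display)
    (T : measurableType d) (P : probability T R) (n : nat) (N : T -> nat) :
    Prop :=
  forall k : nat, (1 <= k <= n)%N -> P (N @^-1` [set k]) = (n%:R^-1)%:E.

Definition seat_excess (R : realType) (m : nat) (T : Type) (p : 'I_m -> R)
    (N : T -> nat) (s : T -> 'I_m -> int) (i : 'I_m) : T -> R :=
  fun w => (s w i)%:~R - (N w)%:R * p i.

(* The data of one experiment: a random house size N, uniform on {1, ..., n},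
   and the random seat vector s.  Only membership of s w among the admissible
   seat vectors is required, so that every (deterministic or random, possibly
   N-dependent) resolution of ties is covered.  The method is undefined when
   N + gamma <= 0; there s is an arbitrary value bounded by C. *)
Record quota_experiment (R : realType) (m : nat) (gamma : R) (p : 'I_m -> R)
    (C : R) (d : measure_display) (T : measurableType d)
    (P : probability T R) (n : nat) (N : {RV P >-> nat})
    (s : T -> 'I_m -> int) : Prop := QuotaExperiment {
  house_uniform : uniform_1_to P n N;
  seats_measurable :
    forall (i : 'I_m) (k : int), measurable [set w | s w i = k];
  seats_quota :
    forall w, 0 < (N w)%:R + gamma -> quota_seats gamma p (N w) (s w);
  seats_default :
    forall w, (N w)%:R + gamma <= 0 -> forall i, `|(s w i)%:~R| <= C
}.

(* Main.v *)
(* Fix a party i and put X_j = (N + gamma)(p_j - p_i) for j != i.  Off ties,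
   s_j - s_i is the floor of X_j or one more, so sum_j s_j = N forces
   m s_i = N - sum_j floor X_j - rho, where rho is the residue of
   N - sum_j floor X_j modulo m, whence
     m Delta_i = - gamma (1 - m p_i) + sum_j frac X_j - rho.
   By Kronecker's theorem a suitable translation of N moves the X_j by almost
   any prescribed amounts modulo m, up to an error of small density, so averages
   over N are asymptotically invariant under such moves.  Moving one X_j by
   0, 1, ..., m-1 averages out rho, moving it by 0, 1/K, ..., (K-1)/K averages out
   frac X_j: in the second moment the m - 1 fractional parts and rho behave like
   independent uniform variables, on [0, 1] and on {0, ..., m-1} respectively, and
   (m - 1)/12 + (m^2 - 1)/12 = (m + 2)(m - 1)/12. *)
Require Import Defs.
From mathcomp Require Import all_boot all_order all_algebra.
From mathcomp Require Import all_classical all_reals all_analysis.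
From mathcomp Require Import measurable_realfun ring lra zify.

Set Implicit Arguments.
Unset Strict Implicit.
Unset Printing Implicit Defensive.

Import Order.TTheory GRing.Theory Num.Theory.
Import numFieldNormedType.Exports.

Local Open Scope classical_set_scope.
Local Open Scope ring_scope.

(** * Simultaneous Diophantine approximation *)

(** Linear independence of 1 and the [th j] over the rationals, with denominators cleared; [b = 0]
    then follows from [a = 0]. *)
Definition int_indep (R : realType) (d : nat) (th : 'I_d -> R) : Prop :=
  forall (a : 'I_d -> int) (b : int),
    \sum_j (a j)%:~R * th j = b%:~R -> forall j, a j = 0.

Definition near_int (R : realType) (e x : R) : Prop :=
  exists k : int, `|x - k%:~R| < e.

Lemma near_intD (R : realType) (e e' x y : R) :
  near_int e x -> near_int e' y -> near_int (e + e') (x + y).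
Proof.
move=> [k hk] [l hl]; exists (k + l); rewrite intrD opprD addrACA.
by rewrite (le_lt_trans (ler_normD _ _))// ltrD.
Qed.

Lemma near_intN (R : realType) (e x : R) : near_int e x -> near_int e (- x).
Proof. by move=> [k hk]; exists (- k); rewrite intrN -opprD normrN. Qed.

Lemma near_int_le (R : realType) (e e' x : R) :
  e <= e' -> near_int e x -> near_int e' x.
Proof. by move=> ee' [k hk]; exists k; exact: lt_le_trans ee'. Qed.

Lemma near_int_intr (R : realType) (e : R) (k : int) :
  0 < e -> near_int e k%:~R.
Proof. by exists k; rewrite subrr normr0. Qed.

(** Pigeonhole: the unit cube is cut into cells of side less than [e], and there is one more
    multiple of [th] than cells. Two multiples share a cell modulo 1, and [q] is the difference of
    their indices. *)
Lemma dirichlet_simultaneous (R : realType) (d : nat) (th : 'I_d -> R)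
    (e : R) :
  0 < e -> exists2 q : nat, (0 < q)%N & forall j, near_int e (q%:R * th j).
Proof.
move=> e0.
have [Q Qe] : exists Q : nat, e^-1 < Q.+1%:R.
  exists (Num.trunc e^-1); have := truncn_itv (ltW _ : 0 <= e^-1).
  by rewrite invr_gt0 e0 => /(_ isT) /andP[].
pose fr (x : R) := x - (Num.floor x)%:~R.
have fr01 x : 0 <= fr x < 1.
  by have := floor_itv x; rewrite /fr intrD => /andP[]; lra.
pose cell (x : R) : 'I_Q.+1 := inord (Num.trunc (Q.+1%:R * fr x)).
have cellP x : (cell x)%:R <= Q.+1%:R * fr x < (cell x).+1%:R.
  have /andP[f0 f1] := fr01 x.
  have h0 : 0 <= Q.+1%:R * fr x by rewrite mulr_ge0.
  have /andP[h1 h2] := truncn_itv h0.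
  rewrite /cell inordK ?h1 ?h2// -(ltr_nat R) (le_lt_trans h1)//.
  by rewrite gtr_pMr.
pose F (n : 'I_(#|{ffun 'I_d -> 'I_Q.+1}|.+1)) : {ffun 'I_d -> 'I_Q.+1} :=
  [ffun j => cell (n%:R * th j)].
have /injectivePn[n1 [n2 n12 F12]] : ~~ injectiveb F.
  by apply/negP => /injectiveP/leq_card; rewrite card_ord ltnn.
have close (a b : 'I_(#|{ffun 'I_d -> 'I_Q.+1}|.+1)) : (a < b)%N -> F a = F b ->
    exists2 q : nat, (0 < q)%N & forall j, near_int e (q%:R * th j).
  move=> ab Fab; exists (b - a)%N; first by rewrite subn_gt0.
  move=> j; have /ffunP/(_ j) := Fab; rewrite !ffunE => cab.
  rewrite natrB ?(ltnW ab)// mulrBl.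
  set x := a%:R * th j in cab *; set y := b%:R * th j in cab *.
  exists (Num.floor y - Num.floor x); rewrite intrB.
  have -> : y - x - ((Num.floor y)%:~R - (Num.floor x)%:~R) = fr y - fr x.
    by rewrite /fr; ring.
  have /andP := cellP x; have /andP := cellP y; rewrite cab.
  rewrite -[(cell y).+1]addn1 natrD => -[y1 y2] [x1 x2].
  have hQ : 1 < Q.+1%:R * e by rewrite -ltr_pdivrMr// div1r.
  have Q0 : 0 < Q.+1%:R :> R by rewrite ltr0n.
  rewrite -(ltr_pM2l Q0) (lt_trans _ hQ)// -[X in X * `|_|](gtr0_norm Q0) -normrM mulrBr.
  by rewrite ltr_norml; apply/andP; split; lra.
case: (ltngtP n1 n2) => [lt|gt|/val_inj eq12].
- exact: close lt F12.
- exact: close gt (esym F12).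
- by rewrite eq12 eqxx in n12.
Qed.

(* Estermann's induction on the dimension: small multiples
   del j of th (mod 1) move along a line in R^d, whose return map to the
   hyperplane {x_0 = h_0 mod 1} is the rotation by the ratios del j / del 0. *)
Lemma kronecker (R : realType) (d : nat) (th h : 'I_d -> R) (e : R) :
  int_indep th -> 0 < e ->
  exists M : int, forall j, near_int e (M%:~R * th j - h j).
Proof.
elim: d th h e => [|d IH] th h e ind e0; first by exists 0 => -[].
have e20 : 0 < e / 2 by rewrite divr_gt0.
have [q q0 hq] := dirichlet_simultaneous th e20.
have /choice [k hk] := hq.
pose del j := q%:R * th j - (k j)%:~R.
(* A relation among the [del j] is an integer relation between 1 and the [th j], with coefficients
   [a j * q]. *)
have del_ind (a : 'I_d.+1 -> int) :
    \sum_j (a j)%:~R * del j = 0 -> forall j, a j = 0.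
  move=> ha j; have := ind (fun j => a j * q%:Z) (\sum_j a j * k j).
  have -> : \sum_j (a j * q%:Z)%:~R * th j = (\sum_j a j * k j)%:~R.
    rewrite raddf_sum/=; apply/eqP; rewrite -subr_eq0 -sumrB -{2}ha; apply/eqP.
    by apply: eq_bigr => i _; rewrite /del !intrM; ring.
  move=> /(_ erefl j)/eqP; rewrite mulf_eq0 => /orP[/eqP//|].
  by rewrite eqz_nat; move: q0; case: (q).
have del0 : del ord0 != 0.
  apply/negP => /eqP d0.
  have := del_ind (fun j => if j == ord0 then 1 else 0).
  rewrite (bigD1 ord0)//= d0 mulr0 big1 ?addr0; last first.
    by move=> i /negbTE ->; rewrite mul0r.
  by move=> /(_ erefl ord0); rewrite eqxx.
pose rho j := del (lift ord0 j) / del ord0.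
have rho_ind : int_indep rho.
  move=> a b hab j.
  have := del_ind (fun i => if unlift ord0 i is Some j then a j else - b).
  rewrite big_ord_recl unlift_none => /(_ _ (lift ord0 j)).
  rewrite liftK; apply; rewrite intrN -hab mulNr mulr_suml -sumrN -big_split/=.
  by apply: big1 => i _; rewrite liftK /rho; field.
have [n hn] := IH rho (fun j => h (lift ord0 j) - h ord0 * rho j) _ rho_ind e20.
(* The real time at which coordinate 0 of the line [t * del] is exactly [h ord0 + n]. The other
   coordinates are then governed by [hn]. *)
pose t := (h ord0 + n%:~R) / del ord0.
have tdel j : near_int (e / 2) (t * del j - h j).
  case: (unliftP ord0 j) => [i ->|->].
    have -> : t * del (lift ord0 i) - h (lift ord0 i) =
        n%:~R * rho i - (h (lift ord0 i) - h ord0 * rho i).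
      by rewrite /t /rho; field.
    exact: hn.
  exists n; rewrite /t mulfVK//.
  by rewrite (addrC (h ord0)) addrK subrr normr0.
(* Rounding the time [t] down to an integer moves coordinate [j] by at most [|del j|], which is less
   than [e / 2]. *)
exists (q%:Z * Num.floor t) => j.
have -> : (q%:Z * Num.floor t)%:~R * th j - h j =
    (t * del j - h j) + ((Num.floor t)%:~R - t) * del j
    + (Num.floor t * k j)%:~R.
  by rewrite !intrM /del; ring.
have [l hl] := tdel j; exists (l + Num.floor t * k j).
rewrite intrD [X in `|X|](_ : _ = (t * del j - h j - l%:~R)
  + ((Num.floor t)%:~R - t) * del j); last by ring.
rewrite (le_lt_trans (ler_normD _ _))// [e]splitr ltr_leD// normrM.
have /andP := floor_itv t; rewrite intrD => -[t1 t2].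
rewrite -[e / 2]mul1r ler_pM//; last exact/ltW/hk.
by rewrite ler_norml; apply/andP; split; lra.
Qed.

(** * Averages over the house size *)

(** Sequences are indexed by [int] because the translations supplied by [kronecker] may be negative;
    the average itself sees only the arguments 1 to [n]. *)
Definition avg (R : realType) (u : int -> R) (n : nat) : R :=
  n%:R^-1 * \sum_(k < n) u k.+1%:Z.

Definition has_mean (R : realType) (u : int -> R) (c : R) : Prop :=
  avg u n @[n --> \oo] --> c.

Lemma avgD (R : realType) (u v : int -> R) n :
  avg (fun N => u N + v N) n = avg u n + avg v n.
Proof. by rewrite /avg big_split mulrDr. Qed.

Lemma avgZ (R : realType) (c : R) (u : int -> R) n :
  avg (fun N => c * u N) n = c * avg u n.
Proof. by rewrite /avg -mulr_sumr mulrCA. Qed.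

Lemma avg_sum (R : realType) (I : finType) (u : I -> int -> R) n :
  avg (fun N => \sum_i u i N) n = \sum_i avg (u i) n.
Proof. by rewrite /avg exchange_big mulr_sumr. Qed.

Lemma avg_cst (R : realType) (c : R) n : (0 < n)%N -> avg (fun=> c) n = c.
Proof.
move=> n0; rewrite /avg sumr_const card_ord -[c *+ n]mulr_natl mulKf//.
by rewrite pnatr_eq0 -lt0n.
Qed.

Lemma ler_avg (R : realType) (u v : int -> R) n :
  (forall N, u N <= v N) -> avg u n <= avg v n.
Proof. by move=> uv; rewrite ler_wpM2l ?invr_ge0// ler_sum. Qed.

Lemma ler_norm_avg (R : realType) (u : int -> R) n :
  `|avg u n| <= avg (fun N => `|u N|) n.
Proof.
rewrite /avg normrM ger0_norm ?invr_ge0// ler_wpM2l ?invr_ge0//.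
exact: ler_norm_sum.
Qed.

Lemma eq_has_mean (R : realType) (u v : int -> R) c :
  u =1 v -> has_mean u c -> has_mean v c.
Proof. by move=> /funext ->. Qed.

Lemma eq_has_mean_pos (R : realType) (u v : int -> R) c :
  (forall k : nat, u k.+1 = v k.+1) -> has_mean u c -> has_mean v c.
Proof.
move=> uv; rewrite /has_mean (_ : avg v = avg u)//.
by apply/funext => n; congr (_ * _); apply: eq_bigr => k _; rewrite uv.
Qed.

Lemma has_meanD (R : realType) (u v : int -> R) c c' :
  has_mean u c -> has_mean v c' -> has_mean (fun N => u N + v N) (c + c').
Proof.
by move=> hu hv; rewrite /has_mean; under eq_cvg do rewrite avgD; exact: cvgD.
Qed.

Lemma has_meanZ (R : realType) (a : R) (u : int -> R) c :
  has_mean u c -> has_mean (fun N => a * u N) (a * c).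
Proof.
move=> hu; rewrite /has_mean; under eq_cvg do rewrite avgZ.
by apply: cvgM => //; exact: cvg_cst.
Qed.

Lemma has_mean_cst (R : realType) (c : R) : has_mean (fun=> c) c.
Proof.
apply/cvgrPdist_le => e e0; near=> n.
by rewrite avg_cst ?subrr ?normr0 ?ltW//; near: n; exact: nbhs_infty_gt.
Unshelve. all: by end_near. Qed.

Lemma has_mean_sum (R : realType) (I : finType)
    (u : I -> int -> R) (c : I -> R) :
  (forall i, has_mean (u i) (c i)) ->
  has_mean (fun N => \sum_i u i N) (\sum_i c i).
Proof.
move=> h; elim: (index_enum I) => [|i s IH].
  apply: (eq_has_mean (u := fun=> 0)) => [N|]; rewrite big_nil//.
  exact: has_mean_cst.
apply: (eq_has_mean (u := fun N => u i N + \sum_(i <- s) u i N)) => [N|].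
  by rewrite big_cons.
by rewrite big_cons; exact: has_meanD.
Qed.

Lemma mean0_approx (R : realType) (u : int -> R) :
  (forall e : R, 0 < e -> exists v w : int -> R,
     [/\ forall N, `|u N - v N| <= w N, has_mean v 0 &
         \forall n \near \oo, avg w n <= e]) ->
  has_mean u 0.
Proof.
move=> h; apply/cvgr0Pnorm_le => e e0.
have [v [w [uvw v0 we]]] := h _ (divr_gt0 e0 (ltr0n R 2)).
near=> n.
have -> : avg u n = avg v n + avg (fun N => u N - v N) n.
  by rewrite -avgD; congr avg; apply/funext => N; rewrite addrC subrK.
rewrite (le_trans (ler_normD _ _))// [e]splitr lerD//.
  near: n; exact: (cvgr0_norm_le _ v0 _ (divr_gt0 e0 (ltr0n R 2))).
rewrite (le_trans (ler_norm_avg _ _))// (le_trans (ler_avg _ uvw))//.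
by near: n.
Unshelve. all: by end_near. Qed.

Lemma mean0_squeeze (R : realType) (u v : int -> R) :
  (forall N, 0 <= u N <= v N) -> has_mean v 0 -> has_mean u 0.
Proof.
move=> uv v0; apply: mean0_approx => e e0.
exists (fun=> 0), v; split => [N||].
- by have /andP[u0 uvN] := uv N; rewrite subr0 ger0_norm.
- exact: has_mean_cst.
- near=> n; apply: le_trans (ler_norm _) _; near: n.
  exact: (cvgr0_norm_le _ v0 _ e0).
Unshelve. all: by end_near. Qed.

(** The sum telescopes to two boundary terms, so the average is at most [2 * B / n] in absolute
    value. *)
Lemma mean0_shift1 (R : realType) (u : int -> R) (B : R) :
  (forall N, `|u N| <= B) -> has_mean (fun N => u (N + 1) - u N) 0.
Proof.
move=> uB; apply/cvgr0Pnorm_le => e e0; near=> n.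
rewrite /avg.
have -> : \sum_(k < n) (u (k.+1%:Z + 1) - u k.+1%:Z) = u n.+1%:Z - u 1%:Z.
  rewrite -(big_mkord xpredT (fun k => u (k.+1%:Z + 1) - u k.+1%:Z)).
  rewrite -(telescope_sumr (fun k => u k.+1%:Z))//; apply: eq_bigr => k _.
  by rewrite -[k.+2]addn1 PoszD.
have n0 : 0 < n%:R :> R by rewrite ltr0n; near: n; exact: nbhs_infty_gt.
rewrite normrM gtr0_norm ?invr_gt0// mulrC ler_pdivrMr//.
rewrite (le_trans (ler_normB _ _))// (le_trans (lerD (uB _) (uB _)))//.
rewrite mulrC -ler_pdivrMr//.
near: n; exact: nbhs_infty_ger.
Unshelve. all: by end_near. Qed.

Lemma mean0_shift (R : realType) (u : int -> R) (B : R) (M : int) :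
  (forall N, `|u N| <= B) -> has_mean (fun N => u (N + M) - u N) 0.
Proof.
have pos (v : int -> R) (k : nat) : (forall N, `|v N| <= B) ->
    has_mean (fun N => v (N + k%:Z) - v N) 0.
  move=> vB; elim: k => [|k IH].
    apply: (eq_has_mean (u := fun=> 0)); last exact: has_mean_cst.
    by move=> N; rewrite addr0 subrr.
  have := has_meanD (mean0_shift1 (fun N => vB (N + k%:Z))) IH.
  rewrite addr0; apply: eq_has_mean => N.
  by rewrite addrA subrK; congr (v _ - _); lia.
(* A negative shift is, up to sign, a positive shift of the translated sequence. *)
move=> uB; case: M => k; first exact: pos.
have := has_meanZ (a := -1) (pos _ k.+1 (fun N => uB (N - k.+1%:Z))).
rewrite mulr0; apply: eq_has_mean => N.
by rewrite addrK NegzE mulN1r opprB.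
Qed.

Definition ind (R : realType) (Q : Prop) : R := (`[< Q >])%:R.

Lemma ind_ge0 (R : realType) (Q : Prop) : 0 <= ind R Q.
Proof. exact: ler0n. Qed.

Lemma ind_le1 (R : realType) (Q : Prop) : ind R Q <= 1.
Proof. by rewrite /ind; case: asboolP. Qed.

Lemma indT (R : realType) (Q : Prop) : Q -> ind R Q = 1.
Proof. by rewrite /ind; case: asboolP. Qed.

Lemma indF (R : realType) (Q : Prop) : ~ Q -> ind R Q = 0.
Proof. by rewrite /ind; case: asboolP. Qed.

Lemma ler_ind (R : realType) (Q Q' : Prop) : (Q -> Q') -> ind R Q <= ind R Q'.
Proof.
by rewrite /ind; case: asboolP; case: asboolP => // nQ' HQ /(_ HQ).
Qed.

Lemma nonint_away (R : realType) (x : R) :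
  (forall k : int, x <> k%:~R) -> exists2 e : R, 0 < e & ~ near_int e x.
Proof.
move=> hx; have /andP := floor_itv x; set f := Num.floor x; rewrite intrD => -[f1 f2].
have f1' : f%:~R < x by rewrite lt_neqAle f1 andbT; apply/eqP => /esym; exact: hx.
exists (Num.min (x - f%:~R) (f%:~R + 1 - x)); first by rewrite lt_min; lra.
move=> [k]; rewrite lt_min => /andP[].
rewrite !ltr_norml => /andP[a1 a2] /andP[b1 b2].
have : f < k by rewrite -(ltr_int R); lra.
rewrite -lezD1 -(ler_int R) intrD.
lra.
Qed.

Lemma multiples_away (R : realType) (th : R) (K : nat) :
  (forall k b : int, k%:~R * th = b%:~R -> k = 0) ->
  exists2 e : R, 0 < e &
    forall i, (0 < i <= K)%N -> ~ near_int e (i%:R * th).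
Proof.
move=> ir; elim: K => [|K [e e0 IH]].
  by exists 1 => // i; rewrite leqn0 => /andP[]; case: i.
have [k|e' e'0 he'] := @nonint_away _ (K.+1%:R * th).
  by move=> /(ir K.+1%:Z).
exists (Num.min e e'); first by rewrite lt_min e0.
move=> i; rewrite [(i <= _)%N]leq_eqVlt => /andP[i0 /orP[/eqP->|iK]].
  by move=> h; apply: he'; apply: near_int_le h; rewrite ge_min lexx orbT.
move=> h; apply: (IH i); first by rewrite i0.
by apply: near_int_le h; rewrite ge_min lexx.
Qed.

(** Two house sizes at distance [i <= K] cannot both be near-integral, since [i * th] would then be
    within [dl] of an integer. Hence each window of [K.+1] consecutive house sizes contains at most
    one. The radius is uniform in [b], as [mean0_translate] needs. *)
Lemma near_int_rare (R : realType) (th e : R) :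
  (forall k b : int, k%:~R * th = b%:~R -> k = 0) -> 0 < e ->
  exists2 dl : R, 0 < dl & forall b : R, \forall n \near \oo,
    avg (fun N : int => ind R (near_int dl (N%:~R * th + b))) n <= e.
Proof.
move=> ir e0.
(* In the numerator 2, one unit pays for the window bound [sum1] and one for replacing the shifted
   averages by [avg E]. *)
have [K Ke] : exists K : nat, 2 / e < K.+1%:R.
  exists (Num.trunc (2 / e)); have := truncn_itv (ltW _ : 0 <= 2 / e).
  by rewrite divr_gt0// => /(_ isT) /andP[].
have [dl dl0 far] := multiples_away K ir.
exists (dl / 2) => [|b]; first by rewrite divr_gt0.
set E := fun N : int => _.
have E01 N : `|E N| <= 1 by rewrite ger0_norm ?ind_ge0 ?ind_le1.
have sep (N : int) (i j : nat) : (i < j <= K)%N ->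
    near_int (dl / 2) ((N + i%:Z)%:~R * th + b) ->
    near_int (dl / 2) ((N + j%:Z)%:~R * th + b) -> False.
  move=> /andP[ij jK] /near_intN hi hj; apply: (far (j - i)%N); first lia.
  have := near_intD hj hi; rewrite -splitr.
  congr (near_int _ _); rewrite !intrD natrB ?(ltnW ij)//; ring.
have sum1 N : \sum_(i < K.+1) E (N + i%:Z) <= 1.
  have [[i hi]|none] := pselect (exists i : 'I_K.+1,
      near_int (dl / 2) ((N + i%:Z)%:~R * th + b)); last first.
    rewrite big1 // => i _; apply: indF => hi; apply: none; by exists i.
  rewrite (bigD1 i)//= big1 ?addr0 ?ind_le1// => j ji; apply: indF => hj.
  case: (ltngtP i j) => [lt|gt|/val_inj eq].
  - by apply: (@sep N i j) => //; rewrite lt -ltnS ltn_ord.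
  - by apply: (@sep N j i) => //; rewrite gt -ltnS ltn_ord.
  - by rewrite eq eqxx in ji.
have := has_mean_sum (fun i : 'I_K.+1 => mean0_shift i%:Z E01).
rewrite big1// => /cvgr0_norm_le /(_ 1 ltr01) near1.
near=> n.
have : `|avg (fun N => \sum_(i < K.+1) (E (N + i%:Z) - E N)) n| <= 1 by near: n.
rewrite ler_norml => /andP[+ _].
have -> : (fun N => \sum_(i < K.+1) (E (N + i%:Z) - E N)) =
    fun N => \sum_(i < K.+1) E (N + i%:Z) + (- K.+1%:R) * E N.
  by apply/funext => N; rewrite sumrB sumr_const card_ord mulNr mulr_natl.
rewrite avgD avgZ.
have n0 : (0 < n)%N by near: n; exact: nbhs_infty_gt.
have := ler_avg n sum1; rewrite avg_cst// => h1 h2.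
have : K.+1%:R * avg E n <= 2 by lra.
rewrite mulrC -ler_pdivlMr ?ltr0n// => /le_trans; apply.
by rewrite ler_pdivrMr ?ltr0n// mulrC -ler_pdivrMr// ltW.
Unshelve. all: by end_near. Qed.

(** * Asymptotic invariance under translation *)

Lemma floor_near (R : realType) (e x y : R) :
  ~ near_int e x -> `|y - x| < e -> Num.floor y = Num.floor x.
Proof.
move=> nx; rewrite ltr_norml => /andP[yx1 yx2].
apply: floor_def; have /andP := floor_itv x; set f := Num.floor x.
rewrite intrD => -[f1 f2].
have h (k : int) : (x - k%:~R <= - e) \/ (e <= x - k%:~R).
  case: (leP e `|x - k%:~R|) => [|he]; last by case: nx; exists k.
  by rewrite ler_normr => /orP[]; [right|left]; lra.
have := h f; have := h (f + 1); rewrite intrD => -[] h1 [] h2;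
  apply/andP; split; lra.
Qed.

(* An observable of the house size N and the position x which sees the integer
   parts of x only modulo q and is Lipschitz on each unit cell. *)
Record cellwise (R : realType) (d q : nat) (B L : R)
    (G : int -> ('I_d -> R) -> R) : Prop := Cellwise {
  cellwise_bounded : forall N x, `|G N x| <= B;
  cellwise_periodic : forall N x M (k : 'I_d -> int),
    G (N + q%:Z * M) (fun j => x j + (q%:Z * k j)%:~R) = G N x;
  cellwise_lipschitz : forall N x y,
    (forall j, Num.floor (x j) = Num.floor (y j)) ->
    `|G N x - G N y| <= L * \sum_j `|x j - y j|
}.

Lemma fin_min_pos (R : realType) (I : finType) (f : I -> R) (e : R) : 0 < e ->
  (forall i, 0 < f i) -> exists dl : R, [/\ 0 < dl, dl <= e & forall i, dl <= f i].
Proof.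
move=> e0 f0.
have [dl [dl0 dle h]] : exists dl : R,
    [/\ 0 < dl, dl <= e & forall i, i \in enum I -> dl <= f i].
  elim: (enum I) => [|i s [dl [dl0 dle h]]]; first by exists e; split.
  exists (Num.min dl (f i)); split; first by rewrite lt_min dl0 f0.
    by rewrite ge_min dle.
  move=> j; rewrite inE => /orP[/eqP ->|/h hj]; first by rewrite ge_min lexx orbT.
  by rewrite ge_min hj.
by exists dl; split => // i; apply: h; rewrite mem_enum.
Qed.

Lemma int_indep_irr (R : realType) (d : nat) (th : 'I_d -> R) (j : 'I_d) :
  int_indep th -> forall k b : int, k%:~R * th j = b%:~R -> k = 0.
Proof.
move=> hi k b hk; have := hi (fun i => if i == j then k else 0) b.
rewrite (bigD1 j)//= eqxx hk big1 ?addr0; last first.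
  by move=> i /negbTE ->; rewrite mul0r.
by move=> /(_ erefl j); rewrite eqxx.
Qed.

(** Translating the position by [h] is imitated by translating [N], which does not change means. The
    two differ little by the Lipschitz bound, unless some coordinate is so near an integer that its
    floor may change, which is rare. *)
Lemma mean0_translate (R : realType) (d q : nat) (B L : R)
    (G : int -> ('I_d -> R) -> R) (th b h : 'I_d -> R) :
  int_indep th -> (0 < q)%N -> 0 <= L -> cellwise q B L G ->
  has_mean (fun N => G N (fun j => N%:~R * th j + b j + h j)
                     - G N (fun j => N%:~R * th j + b j)) 0.
Proof.
move=> hth q0 L0 [GB Gper Glip]; apply: mean0_approx => e e0.
have B0 : 0 <= B := le_trans (normr_ge0 _) (GB 0 b).
have qR0 : 0 < q%:R :> R by rewrite ltr0n.
(* With [d] rare events of density at most [e1], each costing [2 * B], the total is at most [e / 2];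
   the added 1 keeps the denominator positive. *)
pose e1 := e / 2 / (2 * B * d%:R + 1).
have D0 : 0 < 2 * B * d%:R + 1 by rewrite ltr_wpDl// !mulr_ge0.
have e10 : 0 < e1 by rewrite !divr_gt0.
pose rare j := cid2 (near_int_rare (@int_indep_irr _ _ _ j hth) e10).
have L1 : 0 < L * d%:R + 1 by rewrite ltr_wpDl// mulr_ge0.
(* [dl] lies below every rarity radius and makes the Lipschitz error [L * d * dl] at most
   [e / 2]. *)
have [dl [dl0 dle dlj]] := @fin_min_pos R 'I_d (fun j => sval (rare j))
  (e / 2 / (L * d%:R + 1)) (divr_gt0 (divr_gt0 e0 (ltr0n R 2)) L1)
  (fun j => s2valP (rare j)).
(* Aiming at [h / q] and multiplying by [q] turns the integer ambiguity into multiples of [q], which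
   [G] does not see, and shifts [N] by a multiple of [q]. *)
have [M' hM'] := kronecker (fun j => h j / q%:R) hth (divr_gt0 dl0 qR0).
have /choice[k hk] : forall j, exists k : int,
    `|(q%:Z * M')%:~R * th j - h j - (q%:Z * k)%:~R| < dl.
  move=> j; have [k hk] := hM' j; exists k.
  rewrite -(ltr_pM2l (_ : 0 < q%:R^-1)) ?invr_gt0// [ltRHS]mulrC.
  rewrite -[X in X * `|_|]gtr0_norm ?invr_gt0// -normrM (le_lt_trans _ hk)//.
  rewrite le_eqVlt; apply/orP; left; apply/eqP; congr (`|_|).
  by rewrite !intrM; field; rewrite gt_eqF.
pose u N := G N (fun j => N%:~R * th j + b j).
pose E N j := near_int dl (N%:~R * th j + (b j + h j)).
exists (fun N => u (N + q%:Z * M') - u N).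
exists (fun N => L * d%:R * dl + 2 * B * \sum_j ind R (E N j)); split.
- move=> N; rewrite /u opprB addrA subrK.
  have [[j Ej]|none] := pselect (exists j, E N j).
    rewrite (le_trans (ler_normB _ _))// (le_trans (lerD (GB _ _) (GB _ _)))//.
    rewrite ler_wpDl ?mulr_ge0 ?(ltW dl0)//.
    have : 1 <= \sum_j ind R (E N j).
      by rewrite (bigD1 j)//= indT// lerDl sumr_ge0// => *; exact: ind_ge0.
    nra.
  set x := fun j => N%:~R * th j + b j + h j.
  set y := fun j => N%:~R * th j + b j + h j
     + ((q%:Z * M')%:~R * th j - h j - (q%:Z * k j)%:~R).
  have -> : G (N + q%:Z * M') (fun j => (N + q%:Z * M')%:~R * th j + b j) = G N y.
    rewrite -(Gper N y M' k); congr G; apply/funext => j.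
    by rewrite /y !intrD; ring.
  rewrite (le_trans (Glip _ _ _ _))//.
    move=> j; symmetry; apply: (floor_near (e := dl)); last first.
      by rewrite /y /x addrAC subrr add0r.
    by move=> Ej; apply: none; exists j; rewrite /E addrA.
  apply: (@le_trans _ _ (L * d%:R * dl)); last first.
    by rewrite lerDl !mulr_ge0 ?sumr_ge0// => i _; exact: ind_ge0.
  rewrite -mulrA ler_wpM2l// mulr_natl -[leRHS](_ : \sum_(j < d) dl = _); last first.
    by rewrite sumr_const card_ord.
  by apply: ler_sum => j _; rewrite /x /y opprD addrA subrr add0r normrN ltW.
- by apply: mean0_shift => N; exact: GB.
have avgE : \forall n \near \oo, forall j, avg (fun N => ind R (E N j)) n <= e1.
  have near_all (I : eqType) (s : seq I) (Q : I -> nat -> Prop) :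
      (forall i, \forall n \near \oo, Q i n) ->
      \forall n \near \oo, forall i, i \in s -> Q i n.
    move=> hQ; elim: s => [|i s IH]; first by near=> n.
    near=> n; move=> j; rewrite inE => /orP[/eqP ->|]; first by near: n; exact: hQ.
    by move: j; near: n.
  have hall := near_all _ (enum 'I_d) (fun j n => avg (fun N => ind R (E N j)) n <= e1).
  apply: filterS (hall _) => [n hn j|j]; first by apply: hn; rewrite mem_enum.
  near=> n.
  apply: (@le_trans _ _ (avg (fun N => ind R (near_int (sval (rare j))
      (N%:~R * th j + (b j + h j)))) n)).
    by apply: ler_avg => N; apply: ler_ind; exact: near_int_le.
  near: n; rewrite /rare; case: cid2 => ? ? /=; exact.
near=> n.
have n0 : (0 < n)%N by near: n; exact: nbhs_infty_gt.
have hE : forall j, avg (fun N => ind R (E N j)) n <= e1 by near: n.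
rewrite avgD avg_cst// avgZ (avg_sum (fun j N => ind R (E N j))) [e]splitr lerD//.
  move: dle; rewrite ler_pdivlMr// => dle; rewrite (le_trans _ dle)//.
  by rewrite [leLHS]mulrC ler_pM2l// lerDl.
have : \sum_j avg (fun N => ind R (E N j)) n <= d%:R * e1.
  rewrite mulr_natl -[leRHS](_ : \sum_(j < d) e1 = _); last first.
    by rewrite sumr_const card_ord.
  exact: ler_sum.
move=> hs; rewrite (le_trans (ler_wpM2l _ hs)) ?mulr_ge0//.
have -> : e / 2 = e1 * (2 * B * d%:R + 1) by rewrite divfK// gt_eqF.
by rewrite mulrA [leLHS]mulrC ler_pM2l// lerDl.
Unshelve. all: by end_near. Qed.

(** * Moments of fractional parts and residues *)

(** All translates of [G] have asymptotically the same averages, so [G] may be replaced by its mean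
    over finitely many translates. If that mean is nearly the constant [c] at every point, no
    equidistribution statement is needed beyond [mean0_translate]. *)
Lemma has_mean_translates (R : realType) (d q : nat) (B L c : R)
    (G : int -> ('I_d -> R) -> R) (th b : 'I_d -> R) :
  int_indep th -> (0 < q)%N -> 0 <= L -> cellwise q B L G ->
  (forall e : R, 0 < e -> exists2 K : nat, (0 < K)%N &
     exists h : 'I_K -> 'I_d -> R, forall N x,
       `|K%:R^-1 * \sum_t G N (fun j => x j + h t j) - c| <= e) ->
  has_mean (fun N => G N (fun j => N%:~R * th j + b j)) c.
Proof.
move=> hth q0 L0 cG hG; set u := fun N : int => _.
suff h : has_mean (fun N => u N - c) 0.
  have := has_meanD h (has_mean_cst (c := c)); rewrite add0r.
  by apply: eq_has_mean => N; rewrite subrK.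
apply: mean0_approx => e e0; have [K K0 [h hK]] := hG e e0.
pose dG t N := G N (fun j => N%:~R * th j + b j + h t j) - u N.
exists (fun N => - K%:R^-1 * \sum_t dG t N), (fun=> e); split.
- move=> N; apply: le_trans (hK N (fun j => N%:~R * th j + b j)).
  rewrite le_eqVlt; apply/orP; left; apply/eqP; congr (`|_|).
  rewrite /dG sumrB sumr_const card_ord -mulr_natl.
  by field; rewrite pnatr_eq0 -lt0n.
- have := has_meanZ (a := - K%:R^-1) (has_mean_sum (fun t =>
    mean0_translate b (h t) hth q0 L0 cG)).
  by rewrite big1// mulr0.
- near=> n; rewrite avg_cst//; near: n; exact: nbhs_infty_gt.
Unshelve. all: by end_near. Qed.

Lemma cellwiseM (R : realType) (d q : nat) (B L B' L' : R)
    (G G' : int -> ('I_d -> R) -> R) :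
  cellwise q B L G -> cellwise q B' L' G' ->
  cellwise q (B * B') (B * L' + B' * L) (fun N x => G N x * G' N x).
Proof.
move=> [GB Gper Glip] [GB' Gper' Glip']; split => [N x|N x M k|N x y xy].
- by rewrite normrM ler_pM.
- by rewrite Gper Gper'.
- have -> : G N x * G' N x - G N y * G' N y
      = G N x * (G' N x - G' N y) + G' N y * (G N x - G N y) by ring.
  rewrite (le_trans (ler_normD _ _))// !normrM mulrDl -!mulrA.
  by rewrite lerD// ler_pM// ?Glip ?Glip'.
Qed.

Definition cfrac (R : realType) (x : R) : R := x - (Num.floor x)%:~R - 2^-1.

(* [d]/2 is the mean of the residues modulo [d.+1]. *)
Definition cresidue (R : realType) (d : nat) (N : int) (x : 'I_d -> R) : R :=
  ((N - \sum_j Num.floor (x j)) %% d.+1)%Z%:~R - d%:R / 2.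

Lemma cfrac_bound (R : realType) (x : R) : `|cfrac x| <= 2^-1.
Proof.
rewrite /cfrac; have /andP := floor_itv x; rewrite intrD ler_norml => -[? ?].
by apply/andP; split; lra.
Qed.

Lemma floorDint (R : realType) (x : R) (k : int) :
  Num.floor (x + k%:~R) = Num.floor x + k.
Proof. by rewrite floorDrz ?intr_int// intrKfloor. Qed.

Lemma cfracDint (R : realType) (x : R) (k : int) :
  cfrac (x + k%:~R) = cfrac x.
Proof. by rewrite /cfrac floorDint intrD; ring. Qed.

(** The modulus [q] is left free so that [cellwiseM] can pair this with [cresidue], whose modulus is
    [d.+1]. *)
Lemma cellwise_cfrac (R : realType) (d q : nat) (j : 'I_d) :
  cellwise q (2^-1 : R) 1 (fun=> fun x => cfrac (x j)).
Proof.
split => [N x|N x M k|N x y xy]; first exact: cfrac_bound.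
- exact: cfracDint.
- rewrite mul1r /cfrac xy (bigD1 j)//=.
  rewrite (_ : _ - _ = x j - y j); last by ring.
  by rewrite lerDl sumr_ge0.
Qed.

Lemma cellwise_cresidue (R : realType) (d : nat) :
  cellwise d.+1 (d.+1%:R : R) 0 (@cresidue R d).
Proof.
split => [N x|N x M k|N x y xy].
- rewrite /cresidue; set z := N - _.
  have h1 : (z %% d.+1)%Z%:~R < d.+1%:R :> R.
    by rewrite -[ltRHS]/(d.+1%:Z%:~R) ltr_int; exact: ltz_mod.
  have h2 : 0 <= (z %% d.+1)%Z%:~R :> R by rewrite ler0z modz_ge0.
  have h3 : 0 <= d%:R :> R by [].
  by move: h1; rewrite -natr1 ler_norml => h1; apply/andP; split; lra.
- rewrite /cresidue; congr (_%:~R - _).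
  under eq_bigr do rewrite floorDint.
  rewrite big_split/= -mulr_sumr.
  rewrite (_ : _ - _ = (M - \sum_j k j) * d.+1%:Z + (N - \sum_j Num.floor (x j))).
    by rewrite modzMDl.
  by ring.
- rewrite /cresidue (eq_bigr (fun j => Num.floor (y j)))// subrr normr0.
  by rewrite mul0r.
Qed.

Lemma sum_cyclic (R : realType) (F : int -> R) (a : int) (K : nat) :
  (0 < K)%N ->
  \sum_(t < K) F ((a + t%:Z) %% K)%Z = \sum_(t < K) F t%:Z.
Proof.
move=> K0.
have Kz : K%:Z != 0 by rewrite -lt0n in K0 *; case: (K) K0.
under eq_bigr do rewrite -modzDml.
have [n ->] : exists n : nat, (a %% K)%Z = n%:Z.
  by have := modz_ge0 a Kz; case: (_ %% _)%Z => // n _; exists n.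
(* Raising the offset by one moves the first term of the sum to the end. *)
elim: n => [|n IH].
  by apply: eq_bigr => t _; rewrite add0r modz_nat modn_small.
rewrite -{}IH; case: K K0 Kz => // K _ _.
rewrite big_ord_recr big_ord_recl /= addrC; congr (_ + _).
  rewrite addr0 (_ : n.+1%:Z + K%:Z = n%:Z + K.+1%:Z) ?modzDr//; lia.
by apply: eq_bigr => t _; congr (F (_ %% _)%Z); rewrite /= /bump; lia.
Qed.

Definition single (R : realType) (d : nat) (j : 'I_d) (a : R) : 'I_d -> R :=
  fun i => if i == j then a else 0.

(** Lowering [x j] by [t] raises [N - \sum_j floor (x j)] by [t], so the residues run exactly once
    through 0 to [d]. *)
Lemma sum_cresidue (R : realType) (d : nat) (N : int) (x : 'I_d -> R)
    (j : 'I_d) (F : R -> R) :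
  \sum_(t < d.+1) F (cresidue N (fun i => x i + single j (- t%:R) i))
    = \sum_(t < d.+1) F (t%:R - d%:R / 2).
Proof.
rewrite -(sum_cyclic (fun z => F (z%:~R - d%:R / 2))
  (N - \sum_i Num.floor (x i)) (ltn0Sn d)).
apply: eq_bigr => t _; congr F; rewrite /cresidue; congr (_%:~R - _).
congr (_ %% _)%Z; rewrite -addrA; congr (_ + _).
rewrite (bigD1 j)// [in RHS](bigD1 j)//= /single eqxx.
rewrite -[- t%:R](intrN _ t%:Z) floorDint.
under eq_bigr => i /negbTE -> do rewrite addr0.
by rewrite addrAC opprD opprK.
Qed.

(** Modulo 1, the points [x + t / K] fall one into each interval of length [1 / K], all at the same
    relative position [phi], the fractional part of [K * x]. *)
Lemma sum_cfrac (R : realType) (x : R) (K : nat) (F : R -> R) : (0 < K)%N ->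
  exists2 phi : R, 0 <= phi <= 1 &
    \sum_(t < K) F (cfrac (x + t%:R / K%:R))
      = \sum_(t < K) F ((t%:R + phi) / K%:R - 2^-1).
Proof.
move=> K0; have KR0 : 0 < K%:R :> R by rewrite ltr0n.
have Kn : K%:R != 0 :> R by rewrite gt_eqF.
pose a := Num.floor (K%:R * x); pose phi := K%:R * x - a%:~R.
have /andP[phi0 phi1] : 0 <= phi < 1.
  by have := floor_itv (K%:R * x); rewrite /phi /a intrD => /andP[]; lra.
exists phi; first by rewrite phi0 ltW.
have Kz : K%:Z != 0 by case: (K) K0.
rewrite -(sum_cyclic (fun z => F ((z%:~R + phi) / K%:R - 2^-1)) a K0).
apply: eq_bigr => t _; congr F.
set r := ((a + t%:Z) %% K)%Z.
have aE : a%:~R + t%:R = ((a + t%:Z) %/ K)%Z%:~R * K%:R + r%:~R :> R.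
  by have := divz_eq (a + t%:Z) K => /(congr1 (fun z : int => z%:~R : R));
     rewrite !intrD intrM.
have xE : x + t%:R / K%:R = (r%:~R + phi) / K%:R + ((a + t%:Z) %/ K)%Z%:~R.
  have -> : r%:~R = a%:~R + t%:R - ((a + t%:Z) %/ K)%Z%:~R * K%:R :> R.
    by rewrite aE; ring.
  by rewrite /phi; field.
rewrite xE cfracDint /cfrac.
rewrite (_ : Num.floor _ = 0) ?subr0//; apply: floor_def.
rewrite add0r ler_pdivlMr// ltr_pdivrMr// mul0r mul1r.
have r0 : (0 <= r)%R := modz_ge0 _ Kz.
have : r + 1 <= K%:Z by rewrite lezD1; have := ltz_mod (a + t%:Z) Kz.
rewrite -(ler_int R) intrD => rK; move: r0; rewrite -(ler_int R) => r0.
by rewrite addr_ge0//=; move: rK => /=; lra.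
Qed.

Lemma sum_ord_sqr (R : realType) (n : nat) (a b : R) :
  \sum_(t < n) (a * t%:R + b) ^+ 2 =
  a ^+ 2 * (n%:R * (n%:R - 1) * (2 * n%:R - 1)) / 6
  + a * b * n%:R * (n%:R - 1) + b ^+ 2 * n%:R.
Proof.
elim: n => [|n IH]; first by rewrite big_ord0; ring.
by rewrite big_ord_recr IH/= -natr1; field.
Qed.

Lemma sum_ord_lin (R : realType) (n : nat) (a b : R) :
  \sum_(t < n) (a * t%:R + b) = a * n%:R * (n%:R - 1) / 2 + b * n%:R.
Proof.
elim: n => [|n IH]; first by rewrite big_ord0; ring.
by rewrite big_ord_recr IH/= -natr1; field.
Qed.

Lemma ex_invn_le (R : realType) (e : R) : 0 < e ->
  exists2 K : nat, (0 < K)%N & K%:R^-1 <= e.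
Proof.
move=> e0; have := truncn_itv (ltW _ : 0 <= e^-1).
rewrite invr_gt0 => /(_ e0)/andP[_ h]; exists (Num.trunc e^-1).+1 => //.
by rewrite -[leRHS]invrK lef_pV2 ?posrE ?invr_gt0// ltW.
Qed.

Lemma mean_cfrac_sum (R : realType) (K : nat) (x : R) : (0 < K)%N ->
  `|K%:R^-1 * \sum_(t < K) cfrac (x + t%:R / K%:R)| <= K%:R^-1.
Proof.
move=> K0; have K1 : 0 < K%:R :> R by rewrite ltr0n.
have [phi /andP[p0 p1] ->] := sum_cfrac x id K0.
have -> : \sum_(t < K) ((t%:R + phi) / K%:R - 2^-1) =
    \sum_(t < K) (K%:R^-1 * t%:R + (phi / K%:R - 2^-1)) :> R.
  by apply: eq_bigr => t _; ring.
rewrite sum_ord_lin.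
have -> : K%:R^-1 * K%:R * (K%:R - 1) / 2 + (phi / K%:R - 2^-1) * K%:R
    = phi - 2^-1 :> R by field; rewrite gt_eqF.
rewrite normrM gtr0_norm ?invr_gt0// ler_piMr ?invr_ge0//.
by rewrite ler_norml; apply/andP; split; lra.
Qed.

(** The sum is evaluated exactly: the deviation from 1/12 is [(phi ^+ 2 - phi + 1/6) / K ^+ 2]. *)
Lemma mean_cfrac_sum_sqr (R : realType) (K : nat) (x : R) : (0 < K)%N ->
  `|K%:R^-1 * \sum_(t < K) cfrac (x + t%:R / K%:R) ^+ 2 - 12^-1| <= K%:R^-1.
Proof.
move=> K0; have K1 : 0 < K%:R :> R by rewrite ltr0n.
have [phi /andP[p0 p1] ->] := sum_cfrac x (fun y => y ^+ 2) K0.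
have -> : \sum_(t < K) ((t%:R + phi) / K%:R - 2^-1) ^+ 2 =
    \sum_(t < K) (K%:R^-1 * t%:R + (phi / K%:R - 2^-1)) ^+ 2 :> R.
  by apply: eq_bigr => t _; ring.
rewrite sum_ord_sqr.
have -> : K%:R^-1 * (K%:R^-1 ^+ 2 * (K%:R * (K%:R - 1) * (2 * K%:R - 1)) / 6
    + K%:R^-1 * (phi / K%:R - 2^-1) * K%:R * (K%:R - 1)
    + (phi / K%:R - 2^-1) ^+ 2 * K%:R) - 12^-1
    = K%:R^-1 * (K%:R^-1 * (phi ^+ 2 - phi + 6^-1)) :> R.
  by field; rewrite gt_eqF.
rewrite normrM gtr0_norm ?invr_gt0// ler_piMr ?invr_ge0//.
rewrite normrM gtr0_norm ?invr_gt0//.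
have Ki1 : K%:R^-1 <= 1 :> R by rewrite invf_le1// ler1n.
rewrite (le_trans (ler_piMl _ Ki1))//.
by rewrite ler_norml; apply/andP; split; nra.
Qed.

Section Means.
Variables (R : realType) (d : nat) (th b : 'I_d -> R).
Hypotheses (d_gt0 : (0 < d)%N) (th_indep : int_indep th).

Let X (N : int) : 'I_d -> R := fun j => N%:~R * th j + b j.

Lemma has_mean_cfrac j : has_mean (fun N => cfrac (X N j)) 0.
Proof.
apply: (has_mean_translates b th_indep (ltn0Sn 0) ler01 (cellwise_cfrac R 1 j)).
move=> e e0; have [K K0 Ke] := ex_invn_le e0; exists K => //.
exists (fun t => single j (t%:R / K%:R)) => N x.
rewrite /single eqxx subr0.
by rewrite (le_trans (mean_cfrac_sum _ K0)).
Qed.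

(** Only coordinate [j] is translated: for [k] different from [j] the factor [cfrac (x k)] stays
    fixed and the other averages out. *)
Lemma has_mean_cfracM j k :
  has_mean (fun N => cfrac (X N j) * cfrac (X N k)) (if j == k then 12^-1 else 0).
Proof.
apply: (has_mean_translates b th_indep (ltn0Sn 0) _
  (cellwiseM (cellwise_cfrac R 1 j) (cellwise_cfrac R 1 k))) => [|e e0].
  by rewrite mulr1 addr_ge0.
have [K K0 Ke] := ex_invn_le e0; exists K => //.
exists (fun t => single j (t%:R / K%:R)) => N x.
rewrite /single eqxx eq_sym; case: eqP => [->|_].
  by under eq_bigr do rewrite -expr2; rewrite (le_trans (mean_cfrac_sum_sqr _ K0)).
rewrite subr0 addr0 -mulr_suml mulrA normrM.
rewrite -[e]mulr1 ler_pM// ?(le_trans (mean_cfrac_sum _ K0))//.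
by rewrite (le_trans (cfrac_bound _))//; lra.
Qed.

Let j0 : 'I_d := Ordinal d_gt0.

Lemma has_mean_cresidue : has_mean (fun N => cresidue N (X N)) 0.
Proof.
apply: (has_mean_translates b th_indep (ltn0Sn d) _ (cellwise_cresidue R d)) => // e e0.
exists d.+1 => //; exists (fun t => single j0 (- t%:R)) => N x.
rewrite (sum_cresidue N x j0 id).
have -> : \sum_(t < d.+1) (t%:R - d%:R / 2) =
   \sum_(t < d.+1) (1 * t%:R + (- (d%:R / 2))) :> R.
  by apply: eq_bigr => t _; rewrite mul1r.
rewrite sum_ord_lin -natr1 [X in `|X|](_ : _ = 0) ?normr0 ?ltW//.
by field; rewrite natr1 pnatr_eq0.
Qed.

(** The limit is [((d + 1) ^+ 2 - 1) / 12], the variance of a uniform variable on [d + 1]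
    consecutive integers. *)
Lemma has_mean_cresidue_sqr :
  has_mean (fun N => cresidue N (X N) * cresidue N (X N))
    (d%:R * (d%:R + 2) / 12).
Proof.
apply: (has_mean_translates b th_indep (ltn0Sn d) _
  (cellwiseM (cellwise_cresidue R d) (cellwise_cresidue R d))) => [|e e0].
  by rewrite mulr0 addr0.
exists d.+1 => //; exists (fun t => single j0 (- t%:R)) => N x.
rewrite (sum_cresidue N x j0 (fun y => y * y)).
have -> : \sum_(t < d.+1) ((t%:R - d%:R / 2) * (t%:R - d%:R / 2)) =
   \sum_(t < d.+1) (1 * t%:R + (- (d%:R / 2))) ^+ 2 :> R.
  by apply: eq_bigr => t _; rewrite mul1r.
rewrite sum_ord_sqr -natr1 [X in `|X|](_ : _ = 0) ?normr0 ?ltW//.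
by field; rewrite natr1 pnatr_eq0.
Qed.

(** Integer translations of one coordinate cycle the residue while leaving every fractional part
    unchanged, even for [k = j0]. *)
Lemma has_mean_cresidueM k :
  has_mean (fun N => cresidue N (X N) * cfrac (X N k)) 0.
Proof.
apply: (has_mean_translates b th_indep (ltn0Sn d) _
  (cellwiseM (cellwise_cresidue R d) (cellwise_cfrac R d.+1 k))) => [|e e0].
  by rewrite mulr1 mulr0 addr0.
exists d.+1 => //; exists (fun t => single j0 (- t%:R)) => N x.
have E t : cfrac (x k + single j0 (- t%:R) k) = cfrac (x k).
  by rewrite /single; case: eqP => _; rewrite ?addr0// -[- _](intrN _ t%:Z) cfracDint.
under eq_bigr do rewrite E.
rewrite -mulr_suml (sum_cresidue N x j0 id).
have -> : \sum_(t < d.+1) (t%:R - d%:R / 2) =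
   \sum_(t < d.+1) (1 * t%:R + (- (d%:R / 2))) :> R.
  by apply: eq_bigr => t _; rewrite mul1r.
rewrite sum_ord_lin -natr1 [X in `|X|](_ : _ = 0) ?normr0 ?ltW//.
by field; rewrite natr1 pnatr_eq0.
Qed.

Let T N := \sum_j cfrac (X N j) - cresidue N (X N).

Lemma has_mean_excess : has_mean T 0.
Proof.
have := has_meanD (has_mean_sum (fun j => @has_mean_cfrac j))
  (has_meanZ (a := -1) has_mean_cresidue).
rewrite big1// mulr0 addr0; apply: eq_has_mean => N.
by rewrite mulN1r.
Qed.

(** After expansion only the [d] diagonal terms 1/12 and the squared residue survive:
    [d / 12 + d * (d + 2) / 12]. *)
Lemma has_mean_excess_sqr :
  has_mean (fun N => T N ^+ 2) (d%:R * (d%:R + 3) / 12).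
Proof.
have h1 := has_mean_sum (fun j => has_mean_sum (fun k => @has_mean_cfracM j k)).
have h2 := has_meanZ (a := -2) (has_mean_sum (fun k => @has_mean_cresidueM k)).
have := has_meanD (has_meanD h1 h2) has_mean_cresidue_sqr.
rewrite [X in -2 * X]big1// mulr0 addr0.
have -> : \sum_(j < d) \sum_(k < d) (if j == k then 12^-1 else 0) = d%:R / 12 :> R.
  under eq_bigr => j _.
    rewrite (bigD1 j)//= eqxx big1 ?addr0; last first.
      by move=> i /negbTE; rewrite eq_sym => ->.
    over.
  by rewrite sumr_const card_ord mulr_natl.
rewrite [X in has_mean _ X](_ : _ = d%:R * (d%:R + 3) / 12); last by field.
apply: eq_has_mean => N.
under eq_bigr do rewrite -mulr_sumr.
by rewrite -mulr_suml -mulr_sumr /T; ring.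
Qed.

End Means.

(** * Seats *)

Definition gaps (R : realType) (d : nat) (p : 'I_d.+1 -> R) (i : 'I_d.+1) :
  'I_d -> R := fun j => p (lift i j) - p i.

Lemma sum_lift (V : zmodType) (d : nat) (f : 'I_d.+1 -> V) (i : 'I_d.+1) :
  \sum_k f k = f i + \sum_j f (lift i j).
Proof. exact: bigD1_ord. Qed.

(** Writing [b] as [b * \sum_k p k] turns a relation among the gaps into one among the [p k], with
    coefficients [a j - b] at the other parties and [- \sum_j a j - b] at [i]. Their vanishing gives
    [a j = b] for all [j], then [(d + 1) * b = 0]. *)
Lemma int_indep_gaps (R : realType) (d : nat) (p : 'I_d.+1 -> R) (i : 'I_d.+1) :
  \sum_k p k = 1 -> lin_indep_rat p -> int_indep (gaps p i).
Proof.
move=> p1 hp a b hab.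
pose q k : rat := if unlift i k is Some j then (a j - b)%:~R
                  else (- (\sum_j a j) - b)%:~R.
have q0 : forall k, q k = 0.
  apply: hp; rewrite (sum_lift _ i) {1}/q unlift_none ratr_int.
  rewrite [X in _ + X](eq_bigr (fun j => (a j - b)%:~R * p (lift i j))); last first.
    by move=> j _; rewrite /q liftK ratr_int.
  have : \sum_j (a j)%:~R * gaps p i j - b%:~R * \sum_k p k = 0.
    by rewrite hab p1 mulr1 subrr.
  have -> : \sum_j (a j)%:~R * gaps p i j =
      \sum_j (a j)%:~R * p (lift i j) - (\sum_j a j)%:~R * p i.
    by rewrite raddf_sum mulr_suml -sumrB; apply: eq_bigr => j _; rewrite mulrBr.
  have -> : \sum_j (a j - b)%:~R * p (lift i j) =
      \sum_j (a j)%:~R * p (lift i j) - b%:~R * \sum_j p (lift i j).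
    by rewrite mulr_sumr -sumrB; apply: eq_bigr => j _; rewrite intrB mulrBl.
  by rewrite (sum_lift p i) => h0; rewrite -[RHS]h0 intrB intrN; ring.
have ab j : a j = b.
  have := q0 (lift i j); rewrite /q liftK => /eqP.
  by rewrite intr_eq0 subr_eq0 => /eqP.
have b0 : b = 0.
  have := q0 i; rewrite /q unlift_none => /eqP; rewrite intr_eq0.
  under eq_bigr do rewrite ab.
  rewrite sumr_const card_ord => /eqP; lia.
by move=> j; rewrite ab.
Qed.

Section Seats.
Variables (R : realType) (d : nat) (p : 'I_d.+1 -> R) (gamma : R) (N : nat).
Variables (s : 'I_d.+1 -> int) (i : 'I_d.+1).
Hypotheses (p_sum : \sum_k p k = 1) (hs : quota_seats gamma p N s).

Let X j := N%:~R * gaps p i j + gamma * gaps p i j.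
Let m : R := d.+1%:R.

(** Both seat numbers are rounded with the same [alpha], which cancels in the difference. *)
Let seat_gap j : `|(s (lift i j))%:~R - (s i)%:~R - X j| <= 1.
Proof.
have [[al hal] _] := hs.
have /andP[a1 a2] := hal i; have /andP[b1 b2] := hal (lift i j).
rewrite /X /gaps ler_norml; apply/andP; split; lra.
Qed.

Let sum_X : \sum_j X j = (N%:R + gamma) * (1 - m * p i).
Proof.
rewrite /X big_split/= -!mulr_sumr -mulrDl; congr (_ * _).
rewrite /gaps sumrB sumr_const card_ord -p_sum (sum_lift p i) /m -natr1 -mulr_natl.
ring.
Qed.

Let sum_s : \sum_j (s (lift i j) - s i) = N%:Z - d.+1%:Z * s i.
Proof.
have [_] := hs; rewrite (sum_lift s i) => <-.
by rewrite sumrB sumr_const card_ord -mulr_natl; ring.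
Qed.

(** Summing [seat_gap] over the other parties bounds [m] times the excess. The bound is uniform in
    [N] and holds at ties too, so exceptional house sizes contribute little to the moments. *)
Lemma seat_excess_bounded :
  `|(s i)%:~R - N%:R * p i| <= `|gamma * (1 - m * p i)| + 1.
Proof.
have m0 : 0 < m by rewrite ltr0n.
have m1 : 1 <= m by rewrite ler1n.
have : `|\sum_j ((s (lift i j))%:~R - (s i)%:~R - X j)| <= m.
  rewrite (le_trans (ler_norm_sum _ _ _))//.
  rewrite (le_trans (ler_sum _ (fun j _ => seat_gap j)))//.
  by rewrite sumr_const card_ord /m ler_nat.
rewrite sumrB sum_X.
have -> : \sum_j ((s (lift i j))%:~R - (s i)%:~R)
    = N%:R - m * (s i)%:~R :> R.
  transitivity ((\sum_j (s (lift i j) - s i))%:~R : R).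
    by rewrite raddf_sum; apply: eq_bigr => j _; rewrite /= intrB.
  by rewrite sum_s intrB intrM.
set D := (s i)%:~R - _ => h.
rewrite -(ler_pM2l m0) -[X in X * `|_|](gtr0_norm m0) -normrM [leRHS]mulrDr mulr1.
have -> : m * D = - (gamma * (1 - m * p i))
    - (N%:R - m * (s i)%:~R - (N%:R + gamma) * (1 - m * p i)).
  by rewrite /D; ring.
rewrite (le_trans (ler_normB _ _))// normrN lerD//.
by rewrite ler_peMl.
Qed.

(* Off ties each s_j - s_i is the floor of X_j or one more, so N - sum_j floor X_j
   exceeds m s_i by the number of j of the second kind, which is less than m:
   it is the residue of N - sum_j floor X_j modulo m. *)
Lemma seat_excessE :
  (forall j (k : int), X j <> k%:~R) ->
  (s i)%:~R - N%:R * p i =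
    - (gamma * (1 - m * p i)) / m
    + m^-1 * (\sum_j cfrac (X j) - cresidue N%:Z X).
Proof.
move=> noties.
have m0 : 0 < m by rewrite ltr0n.
pose e j := s (lift i j) - s i - Num.floor (X j).
have e01 j : 0 <= e j <= 1.
  have /andP[f1 f2] := floor_itv (X j).
  (* Strictness excludes [e j = -1], which [seat_gap] would allow at a tie. *)
  have f1' : (Num.floor (X j))%:~R < X j.
    by rewrite lt_neqAle f1 andbT; apply/eqP => /esym; exact: noties.
  have := seat_gap j; rewrite ler_norml => /andP[g1 g2].
  have : (-1 : int) < e j.
    by rewrite -(ltr_int R) /e !intrB intrN; lra.
  have : e j < 2.
    by rewrite -(ltr_int R) /e !intrB; move: f2; rewrite intrD; lra.
  by move=> *; apply/andP; split; lia.
have sum_e0 : 0 <= \sum_j e j by rewrite sumr_ge0// => j _; case/andP: (e01 j).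
have sum_e1 : \sum_j e j <= d%:Z.
  rewrite (le_trans (ler_sum _ (fun j _ => proj2 (andP (e01 j)))))//.
  by rewrite sumr_const card_ord natz.
have eE : N%:Z - \sum_j Num.floor (X j) = s i * d.+1%:Z + \sum_j e j.
  by rewrite /e sumrB sum_s; ring.
rewrite /cresidue eE modzMDl modz_small; last first.
  by rewrite sum_e0 (le_lt_trans sum_e1)// ltz_nat.
have -> : (\sum_j e j)%:~R =
    N%:R - m * (s i)%:~R - \sum_j (Num.floor (X j))%:~R :> R.
  have -> : \sum_j e j = N%:Z - \sum_j Num.floor (X j) - s i * d.+1%:Z.
    by rewrite eE; ring.
  by rewrite !intrB intrM raddf_sum/=; ring.
rewrite /cfrac !sumrB sum_X sumr_const card_ord -[2^-1 *+ d]mulr_natl.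
by field; rewrite addrC natr1 pnatr_eq0.
Qed.

End Seats.

(** * Expectations under a uniform house size *)

Section UniformExpectation.
Variables (R : realType) (dd : measure_display) (T : measurableType dd).
Variables (P : probability T R) (n : nat) (N : {RV P >-> nat}).
Hypotheses (n_gt0 : (0 < n)%N) (N_unif : uniform_1_to P n N).

Lemma bounded_integrable (X : T -> R) (B : R) :
  measurable_fun setT X -> (forall w, `|X w| <= B) ->
  P.-integrable setT (EFin \o X).
Proof.
move=> mX XB; apply: measurable_bounded_integrable => //.
  by rewrite (le_lt_trans (probability_le1 _ _))// ltry.
exists B; split; first exact: num_real.
by move=> b Bb w _ /=; rewrite (le_trans (XB w))// ltW.
Qed.

Lemma measurable_fun_comp_nat (f : nat -> R) :
  measurable_fun setT (fun w => f (N w)).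
Proof.
by apply: (measurableT_comp (f := f)) => // _ Y mY; rewrite setTI.
Qed.

(** Induction on the support of [f]: the value at [k.+1] is split off as a multiple of the indicator
    of [N = k.+1], an event of probability [1 / n]. *)
Lemma Rintegral_comp_uniform (k : nat) (f : nat -> R) (B : R) :
  (k <= n)%N -> (forall j, `|f j| <= B) ->
  (forall j, ~~ (1 <= j <= k)%N -> f j = 0) ->
  \int[P]_w f (N w) = n%:R^-1 * \sum_(j < k) f j.+1.
Proof.
elim: k f => [|k IH] f kn fB f0.
  rewrite big_ord0 mulr0.
  under eq_Rintegral do rewrite f0 ?leqn0 ?lt0n ?andNb//.
  by rewrite Rintegral_cst// mul0r.
pose g j := if j == k.+1 then 0 else f j.
have gB j : `|g j| <= B.
  by rewrite /g; case: ifP => // _; rewrite normr0 (le_trans _ (fB 0%N)).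
pose h w := f k.+1 * \1_(N @^-1` [set k.+1]) w.
have mN : measurable (N @^-1` [set k.+1]) by rewrite -[X in measurable X]setTI; exact: measurable_funPT.
have ih : P.-integrable setT (EFin \o \1_(N @^-1` [set k.+1])).
  apply: (@bounded_integrable _ 1) => // w.
  by rewrite indicE; case: (_ \in _); rewrite ?normr1 ?normr0.
under eq_Rintegral => w _.
  rewrite (_ : f (N w) = g (N w) + h w); last first.
    rewrite /g /h indicE; case: eqP => [Ek|neq].
      by rewrite Ek add0r mem_set ?mulr1.
    by rewrite memNset ?mulr0 ?addr0.
  over.
rewrite RintegralD//; last 2 first.
- exact: (bounded_integrable (measurable_fun_comp_nat g)).
- apply: (@bounded_integrable _ B) => [|w].
    exact: measurable_funM.
  rewrite /h normrM indicE; case: (_ \in _); rewrite ?normr1 ?normr0 ?mulr1 ?mulr0//.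
  by rewrite (le_trans _ (fB 0%N)).
rewrite (IH g (ltnW kn) gB); last first.
  by move=> j jk; rewrite /g; case: eqP => // neq; apply: f0; lia.
rewrite RintegralZl// /Rintegral integral_indic// setIT.
have kn1 : (1 <= k.+1 <= n)%N by [].
rewrite [fine _](_ : _ = n%:R^-1); last exact: (congr1 fine (N_unif kn1)).
rewrite big_ord_recr/= mulrDr [f _ * _]mulrC; congr (_ * _ + _).
by apply: eq_bigr => j _; rewrite /g eqSS ltn_eqF.
Qed.

(** [X] may depend on more than the house size when ties are resolved at random, so it is only
    compared with [D (N w)], at a cost of [2 * B] on the bad house sizes. *)
Lemma expectation_near_avg (X : T -> R) (D : int -> R) (B : R) (bad : int -> Prop) :
  measurable_fun setT X -> (forall w, `|X w| <= B) -> (forall k, `|D k| <= B) ->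
  (forall w, ~ bad (N w) -> X w = D (N w)) ->
  `|fine 'E_P[X] - avg D n| <= 2 * B * avg (fun k => ind R (bad k)) n.
Proof.
move=> mX XB DB XD.
have B0 : 0 <= B := le_trans (normr_ge0 _) (DB 0).
(* Both [g] and [h] vanish outside 1 to [n], so their integrals are finite sums. There [1 - h]
   equals 1, so [2 * B * (1 - h)] dominates [|X - g|] everywhere. *)
pose g j : R := if (1 <= j <= n)%N then D j%:Z else 0.
pose h j : R := if (1 <= j <= n)%N then 1 - ind R (bad j%:Z) else 0.
have gB j : `|g j| <= B by rewrite /g; case: ifP => // _; rewrite normr0.
have hB j : `|h j| <= 1.
  rewrite /h; case: ifP => // _; rewrite ?normr0//.
  by rewrite ger0_norm ?subr_ge0 ?ind_le1// gerBl ind_ge0.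
have intg : \int[P]_w g (N w) = avg D n.
  rewrite (Rintegral_comp_uniform (leqnn n) gB); last first.
    by move=> j /negbTE; rewrite /g => ->.
  by congr (_ * _); apply: eq_bigr => j _; rewrite /g ltn_ord.
have inth : \int[P]_w h (N w) = 1 - avg (fun k => ind R (bad k)) n.
  rewrite (Rintegral_comp_uniform (leqnn n) hB); last first.
    by move=> j /negbTE; rewrite /h => ->.
  rewrite -[X in X - _](avg_cst 1 n_gt0) -mulN1r -avgZ -avgD.
  congr (_ * _); apply: eq_bigr => j _.
  by rewrite /h ltn_ord mulN1r.
have iX := bounded_integrable mX XB.
have ig := bounded_integrable (measurable_fun_comp_nat g) (fun w => gB (N w)).
have ih := bounded_integrable (measurable_fun_comp_nat h) (fun w => hB (N w)).
have ic c : P.-integrable setT (EFin \o (fun _ : T => c)).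
  exact: (@bounded_integrable _ `|c|).
have -> : fine 'E_P[X] = \int[P]_w X w by rewrite unlock.
rewrite -intg -RintegralB//.
have mXg : measurable_fun setT (fun w => X w - g (N w)).
  exact: measurable_funB mX (measurable_fun_comp_nat g).
have mh' : measurable_fun setT (fun w => 2 * B * (1 - h (N w))).
  by apply: measurable_funM => //; apply: measurable_funB => //; exact: measurable_fun_comp_nat.
rewrite (le_trans (le_normr_Rintegral _ _))//.
  by apply: (@bounded_integrable _ (B + B)) => // w; rewrite (le_trans (ler_normB _ _))// lerD.
rewrite (@le_trans _ _ (\int[P]_w (2 * B * (1 - h (N w)))))//.
  apply: le_Rintegral => //.
  - apply: (@bounded_integrable _ (B + B)) => [|w]; first exact: measurableT_comp.
    by rewrite /= normr_id (le_trans (ler_normB _ _))// lerD.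
  - apply: (@bounded_integrable _ (2 * B * 2)) => // w.
    rewrite normrM [X in X * _]ger0_norm ?mulr_ge0// ler_wpM2l ?mulr_ge0//.
    rewrite (le_trans (ler_normB _ _))// normr1 -[leRHS]/(1 + 1) lerD//.
  - move=> w _; rewrite /g /h; case: ifP => _; last first.
      by rewrite subr0 subr0 mulr1 (le_trans (XB w))// mulr_natl mulr2n lerDl.
    have [hb|hb] := pselect (bad (N w)).
      rewrite indT// subrr subr0 mulr1 (le_trans (ler_normB _ _))//.
      by rewrite mulr_natl mulr2n lerD.
    by rewrite indF// subr0 subrr mulr0 XD// subrr normr0.
rewrite RintegralZl//; last first.
  apply: (@bounded_integrable _ 2) => [|w].
    by apply: measurable_funB => //; exact: measurable_fun_comp_nat.
  by rewrite (le_trans (ler_normB _ _))// normr1 -[leRHS]/(1 + 1) lerD.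
rewrite RintegralB// inth Rintegral_cst//.
rewrite [fine _](_ : _ = 1) ?mul1r; last exact: (congr1 fine (@probability_setT _ _ _ P)).
by rewrite opprB addrC subrK.
Qed.

End UniformExpectation.

(** * The limit of the variance *)

(** Shifted by [M.+1 > - gamma], the indicator vanishes at all positive [k], so on these it is minus
    the difference treated by [mean0_shift]. *)
Lemma mean0_bounded_above (R : realType) (gamma : R) :
  has_mean (fun k : int => ind R (k%:~R + gamma <= 0)) 0.
Proof.
set u := fun k : int => _.
have u1 k : `|u k| <= 1 by rewrite ger0_norm ?ind_ge0 ?ind_le1.
have [M hM] : exists M : nat, - gamma < M.+1%:R.
  exists (Num.trunc `|gamma|); have /andP[_] := truncn_itv (normr_ge0 gamma).
  by apply: le_lt_trans; rewrite -normrN ler_norm.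
have := has_meanZ (a := -1) (mean0_shift M.+1%:Z u1).
rewrite mulr0; apply: eq_has_mean_pos => k.
rewrite {1}/u indF ?sub0r ?mulN1r ?opprK// intrD => h.
have : 0 <= k.+1%:Z%:~R :> R by rewrite ler0z.
by move: h hM => /=; lra.
Qed.

Lemma mean0_tie (R : realType) (th b : R) :
  (forall k b : int, k%:~R * th = b%:~R -> k = 0) ->
  has_mean (fun k : int => ind R (exists l : int, k%:~R * th + b = l%:~R)) 0.
Proof.
move=> ir; apply: mean0_approx => e e0.
have [dl dl0 hdl] := near_int_rare ir e0.
exists (fun=> 0), (fun N => ind R (near_int dl (N%:~R * th + b))); split.
- move=> N; rewrite subr0 ger0_norm ?ind_ge0//; apply: ler_ind => -[l ->].
  exact: near_int_intr.
- exact: has_mean_cst.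
- exact: hdl.
Qed.

(** The excess is a function of the pair of [N] and [s i], which takes countably many values, so
    preimages are countable unions of level sets. *)
Lemma measurable_seat_excess (R : realType) (m : nat) (dd : measure_display)
    (T : measurableType dd) (P : probability T R) (p : 'I_m -> R)
    (N : {RV P >-> nat}) (s : T -> 'I_m -> int) (i : 'I_m) :
  (forall k : int, measurable [set w | s w i = k]) ->
  measurable_fun setT (seat_excess p N s i).
Proof.
move=> ms _ Y mY; rewrite setTI.
pose F (a : nat * int) : set T :=
  [set w | [/\ N w = a.1, s w i = a.2 & Y (a.2%:~R - a.1%:R * p i)]].
rewrite (_ : _ @^-1` _ = \bigcup_a F a); last first.
  apply/seteqP; split => [w Yw|w [a _ [/= Na sa]]].
    by exists (N w, s w i).
  by rewrite /= /seat_excess Na sa.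
apply: countable_bigcupT_measurable => [|a]; first exact: countableP.
have [hY|nY] := pselect (Y (a.2%:~R - a.1%:R * p i)); last first.
  by rewrite (_ : F a = set0)// -subset0 => w [].
rewrite (_ : F a = (N @^-1` [set a.1]) `&` [set w | s w i = a.2]).
  apply: measurableI; last exact: ms.
  by rewrite -[X in measurable X]setTI; exact: measurable_funPT.
by apply/seteqP; split => w [].
Qed.

Lemma variance_bounded (R : realType) (dd : measure_display)
    (T : measurableType dd) (P : probability T R) (X : T -> R) (B : R) :
  measurable_fun setT X -> (forall w, `|X w| <= B) ->
  'V_P[X] = (fine 'E_P[(fun w => X w * X w)] - fine 'E_P[X] ^+ 2)%:E.
Proof.
move=> mX XB.
have LX : X \in Lfun P 1%E by apply/Lfun1_integrable; exact: bounded_integrable mX XB.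
have LXX : (X * X)%R \in Lfun P 1%E.
  apply/Lfun1_integrable; apply: (@bounded_integrable _ _ _ _ _ (B * B)).
    exact: measurable_funM.
  by move=> w; rewrite normrM ler_pM.
rewrite /variance covarianceE// EFinB EFinM !fineK// ?expectation_fin_num//.
Qed.

Lemma variance_seat_excess (R : realType) (d : nat) (p : 'I_d.+1 -> R)
    (gamma C : R) (dd : nat -> measure_display)
    (T : forall n, measurableType (dd n)) (P : forall n, probability (T n) R)
    (N : forall n, {RV (P n) >-> nat}) (s : forall n, T n -> 'I_d.+1 -> int)
    (i : 'I_d.+1) :
  (0 < d)%N -> \sum_k p k = 1 -> lin_indep_rat p ->
  (forall n, (0 < n)%N -> quota_experiment gamma p C n (N n) (s n)) ->
  ('V_(P n)[seat_excess p (N n) (s n) i] @[n --> \oo]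
    --> (d%:R * (d%:R + 3) / 12 / d.+1%:R ^+ 2 : R)%:E)%E.
Proof.
move=> d0 p1 p_indep hs; pose m : R := d.+1%:R.
have m0 : 0 < m by rewrite ltr0n.
have th_indep := int_indep_gaps (i := i) p1 p_indep.
pose X k j : R := k%:~R * gaps p i j + gamma * gaps p i j.
pose c0 := - (gamma * (1 - m * p i)) / m.
pose S k := \sum_j cfrac (X k j) - cresidue k (X k).
pose D k := c0 + m^-1 * S k.
have meanS : has_mean S 0 := has_mean_excess _ d0 th_indep.
have meanS2 : has_mean (fun k => S k ^+ 2) _ := has_mean_excess_sqr _ d0 th_indep.
have meanD : has_mean D c0.
  have := has_meanD (has_mean_cst (c := c0)) (has_meanZ (a := m^-1) meanS).
  by rewrite mulr0 addr0.
have meanD2 : has_mean (fun k => D k * D k)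
    (c0 ^+ 2 + m^-1 ^+ 2 * (d%:R * (d%:R + 3) / 12)).
  have := has_meanD (has_meanD (has_mean_cst (c := c0 ^+ 2))
    (has_meanZ (a := 2 * c0 * m^-1) meanS)) (has_meanZ (a := m^-1 ^+ 2) meanS2).
  rewrite mulr0 addr0; apply: eq_has_mean => k.
  by rewrite /D; ring.
(* House sizes where the method is undefined or the formula [D] may fail because of a tie. *)
pose bad k := k%:~R + gamma <= 0 \/ exists j, exists l : int, X k j = l%:~R.
have mean_bad : has_mean (fun k => ind R (bad k)) 0.
  have ties := has_mean_sum (fun j => mean0_tie (gamma * gaps p i j)
    (@int_indep_irr _ _ _ j th_indep)).
  have := has_meanD (mean0_bounded_above gamma) ties.
  rewrite big1// addr0; apply: mean0_squeeze => k; rewrite ind_ge0/=.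
  have sum0 : 0 <= \sum_j ind R (exists l : int,
      k%:~R * gaps p i j + gamma * gaps p i j = l%:~R).
    by rewrite sumr_ge0// => j _; exact: ind_ge0.
  have [hb|/indF ->] := pselect (bad k); last by rewrite addr_ge0// ind_ge0.
  rewrite (le_trans (ind_le1 _ _))//; case: hb => [hk|[j hj]].
    by rewrite indT// lerDl.
  rewrite ler_wpDl ?ind_ge0// (bigD1 j)//= [leRHS](congr1 (+%R^~ _) (indT R hj)).
  by rewrite lerDl sumr_ge0// => l _; exact: ind_ge0.
(* The last summand bounds [D]. The third bounds the excess where the method applies, and the first
   two bound it where [N + gamma <= 0], since then [N <= |gamma|]. *)
pose B := `|C| + `|gamma| * `|p i| + (`|gamma * (1 - m * p i)| + 1)
  + (`|c0| + m^-1 * (d%:R + m)).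
have DB k : `|D k| <= B.
  rewrite ler_wpDl ?addr_ge0 ?mulr_ge0//.
  rewrite (le_trans (ler_normD _ _))// lerD// normrM gtr0_norm ?invr_gt0//.
  rewrite ler_pM2l ?invr_gt0// (le_trans (ler_normB _ _))// lerD//; last first.
    exact: (cellwise_bounded (cellwise_cresidue R d)).
  rewrite (le_trans (ler_norm_sum _ _ _))//.
  have -> : d%:R = \sum_(j < d) 1 :> R by rewrite sumr_const card_ord.
  apply: ler_sum => j _; rewrite (le_trans (cfrac_bound _))//; lra.
have XB n w : (0 < n)%N -> `|seat_excess p (N n) (s n) i w| <= B.
  move=> n0; have hn := hs n n0; rewrite /seat_excess /B.
  have [hN|hN] := ltP 0 ((N n w)%:R + gamma).
    apply: le_trans (seat_excess_bounded i p1 (seats_quota hn hN)) _.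
    have h1 : 0 <= `|C| + `|gamma| * `|p i| by rewrite addr_ge0 ?mulr_ge0.
    have h2 : 0 <= `|c0| + m^-1 * (d%:R + m).
      by rewrite addr_ge0// mulr_ge0 ?invr_ge0 ?addr_ge0 ?(ltW m0).
    by rewrite -[leLHS]add0r -[leLHS]addr0 lerD// lerD.
  have h2 : 0 <= `|gamma * (1 - m * p i)| + 1 by rewrite addr_ge0.
  have h3 : 0 <= `|c0| + m^-1 * (d%:R + m).
    by rewrite addr_ge0// mulr_ge0 ?invr_ge0 ?addr_ge0 ?(ltW m0).
  have h4 : `|(s n w i)%:~R| <= `|C|.
    by rewrite (le_trans (seats_default hn hN i))// ler_norm.
  have h5 : `|(N n w)%:R * p i| <= `|gamma| * `|p i|.
    rewrite normrM ler_wpM2r// ger0_norm// -normrN (le_trans _ (ler_norm _))//.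
    by lra.
  rewrite (le_trans (ler_normB _ _))// -[leLHS]addr0 -[leLHS]addr0.
  by rewrite lerD// lerD// lerD.
have mX n : (0 < n)%N -> measurable_fun setT (seat_excess p (N n) (s n) i).
  by move=> n0; apply: measurable_seat_excess; exact: (seats_measurable (hs n n0)).
have XD n w : (0 < n)%N -> ~ bad (N n w) ->
    seat_excess p (N n) (s n) i w = D (N n w).
  move=> n0 nb; rewrite /seat_excess.
  rewrite (seat_excessE p1 (seats_quota (hs n n0) _))//.
    by rewrite ltNge; apply/negP => h; apply: nb; left.
  by move=> j k h; apply: nb; right; exists j, k.
have cvgE (Y : forall n, T n -> R) (E : int -> R) (b c : R) : has_mean E c ->
    (forall n, (0 < n)%N -> `|fine 'E_(P n)[Y n] - avg E n|
       <= b * avg (fun k => ind R (bad k)) n) ->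
    fine 'E_(P n)[Y n] @[n --> \oo] --> c.
  move=> Ec YE.
  have h0 : (fine 'E_(P n)[Y n] - avg E n) @[n --> \oo] --> (0 : R).
    have hb : b * avg (fun k => ind R (bad k)) n @[n --> \oo] --> (0 : R).
      by rewrite -(mulr0 b); apply: cvgM => //; exact: cvg_cst.
    apply/cvgr0Pnorm_le => e e0; near=> n.
    have n0 : (0 < n)%N by near: n; exact: nbhs_infty_gt.
    rewrite (le_trans (YE n n0))//.
    rewrite (le_trans (ler_norm _))//; near: n.
    exact: (cvgr0_norm_le _ hb _ e0).
  rewrite (_ : (fun n => _) =
      (fun n => (fine 'E_(P n)[Y n] - avg E n) + avg E n)); last first.
    by apply/funext => n; rewrite subrK.
  by rewrite -(add0r c); exact: cvgD.
have cvg1 : fine 'E_(P n)[seat_excess p (N n) (s n) i] @[n --> \oo] --> c0.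
  apply: (cvgE (fun n => seat_excess p (N n) (s n) i) D (2 * B) c0 meanD) => n n0.
  apply: (expectation_near_avg n0 (house_uniform (hs n n0)) (mX n n0)) => // w.
    exact: XB.
  exact: XD.
have cvg2 : fine 'E_(P n)[(fun w => seat_excess p (N n) (s n) i w
      * seat_excess p (N n) (s n) i w)] @[n --> \oo]
    --> c0 ^+ 2 + m^-1 ^+ 2 * (d%:R * (d%:R + 3) / 12).
  apply: (cvgE (fun n w => seat_excess p (N n) (s n) i w
    * seat_excess p (N n) (s n) i w) _ (2 * (B * B)) _ meanD2) => n n0.
  apply: (expectation_near_avg n0 (house_uniform (hs n n0))) => [||k|w nb].
  - exact: measurable_funM (mX n n0) (mX n n0).
  - by move=> w; rewrite normrM ler_pM// XB.
  - by rewrite normrM ler_pM.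
  - by rewrite XD.
apply/fine_cvgP; split.
  near=> n; have n0 : (0 < n)%N by near: n; exact: nbhs_infty_gt.
  by rewrite (variance_bounded (P n) (mX n n0) (fun w => XB n w n0)).
(* The mean [c0] cancels, so the limit does not depend on [gamma]. *)
rewrite (_ : _ / _ = c0 ^+ 2 + m^-1 ^+ 2 * (d%:R * (d%:R + 3) / 12) - c0 * c0);
  last by rewrite exprVn; ring.
apply: cvg_trans (cvgB cvg2 (cvgM cvg1 cvg1)); apply: near_eq_cvg; near=> n.
have n0 : (0 < n)%N by near: n; exact: nbhs_infty_gt.
by rewrite /= (variance_bounded (P n) (mX n n0) (fun w => XB n w n0)).
Unshelve. all: by end_near. Qed.

Unset Implicit Arguments.

Theorem corollary3p14 (R : realType) (m : nat) (hm : (2 <= m)%N)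
  (p : 'I_m -> R) (p_gt0 : forall i, 0 < p i) (p_sum : \sum_i p i = 1)
  (p_indep : lin_indep_rat p) (gamma C : R)
  (d : nat -> measure_display) (T : forall N0 : nat, measurableType (d N0))
  (P : forall N0 : nat, probability (T N0) R)
  (N : forall N0 : nat, {RV (P N0) >-> nat})
  (s : forall N0 : nat, T N0 -> 'I_m -> int)
  (hs : forall N0 : nat, (0 < N0)%N ->
     quota_experiment gamma p C N0 (N N0) (s N0)) :
  (forall i : 'I_m,
     ('V_(P N0)[seat_excess p (N N0) (s N0) i] @[N0 --> \oo]
       --> ((1 + (m%:R - 2) / m%:R ^+ 2) / 12 : R)%:E)%E) /\
  (1 + (m%:R - 2) / m%:R ^+ 2) / 12
    = (m%:R + 2) * (m%:R - 1) / (12 * m%:R ^+ 2) :> R.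
Proof.
have mE : (1 + (m%:R - 2) / m%:R ^+ 2) / 12
    = (m%:R + 2) * (m%:R - 1) / (12 * m%:R ^+ 2) :> R.
  by field; rewrite pnatr_eq0 -lt0n (ltn_trans _ hm).
split => // i; rewrite mE.
case: m hm p p_gt0 p_sum p_indep s hs i {mE} => // k hk p _ p1 pi s hs i.
(* With [m = k + 1], [(m + 2) * (m - 1)] is [k * (k + 3)]. *)
rewrite (_ : _ / _ = k%:R * (k%:R + 3) / 12 / k.+1%:R ^+ 2).
  exact: (variance_seat_excess i hk p1 pi hs).
by rewrite -natr1; field; rewrite natr1 pnatr_eq0.
Qed.
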